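(* The triangle inequalities do not remain valid for translation triangles in $\mathbf{Nil}$ in general: there exists a translation triangle $A_1A_2A_3$ in $\mathbf{Nil}$ such that $$d^t(A_2,A_3)+d^t(A_1,A_3)<d^t(A_1,A_2).$$
   Context: $\mathbf{Nil}$ is $\mathbb{R}^3$ with the Heisenberg group structure: for $P=(p,q,r)$ the translation by $P$ is the map $\mathbf{T}_P:(a,b,c)\mapsto(p+a,\;q+b,\;r+pb+c)$, which carries the origin $O=(0,0,0)$ to $P$. The translation-invariant Riemannian metric is $ds^2=dx^2+dy^2+(dz-x\,dy)^2$, and the translations are isometries of it. A translation curve starting at $O$ with initial vector $(u,v,w)$ is $x(t)=ut,\ y(t)=vt,\ z(t)=\tfrac12uvt^2+wt$. Translation curves starting at another point $P$ are the images of these under $\mathbf{T}_P$. The translation distance $d^t(P_1,P_2)$ is the arc length of the translation curve from $P_1$ to $P_2$. Explicitly, $d^t(O,(x,y,z))=\sqrt{x^2+y^2+(z-\tfrac12xy)^2}$ and $d^t(P_1,P_2)=d^t(O,\mathbf{T}_{P_1}^{-1}(P_2))$. A translation triangle $A_1A_2A_3$ is given by three points not all lying on one translation curve; its sides are the translation curve segments joining pairs of vertices, and the length of the side joining $A_i,A_j$ is $d^t(A_i,A_j)$. *)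

(* Defs.v *)
From Stdlib Require Import Reals.
From Coquelicot Require Import Coquelicot.
Open Scope R_scope.

(* Points of Nil and tangent vectors, both in the coordinates of R^3. *)
Definition point : Type := (R * R * R)%type.
Definition vect : Type := (R * R * R)%type.

Definition origin : point := (0, 0, 0).

Definition translation (P A : point) : point :=
  let '(p, q, r) := P in let '(a, b, c) := A in
  (p + a, q + b, r + p * b + c).

Definition translation_inv (P A : point) : point :=
  let '(p, q, r) := P in let '(a, b, c) := A in
  (a - p, b - q, c - r - p * (b - q)).

Lemma translationK (P A : point) :
  translation_inv P (translation P A) = A.
Proof.
destruct P as [[p q] r], A as [[a b] c]; unfold translation, translation_inv.
repeat f_equal; ring.
Qed.

Lemma translation_invK (P A : point) :
  translation P (translation_inv P A) = A.
Proof.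
destruct P as [[p q] r], A as [[a b] c]; unfold translation, translation_inv.
repeat f_equal; ring.
Qed.

(* The quadratic form ds^2 = dx^2 + dy^2 + (dz - x dy)^2 at P, on X. *)
Definition metric (P : point) (X : vect) : R :=
  let '(x, _, _) := P in let '(dx, dy, dz) := X in
  dx ^ 2 + dy ^ 2 + (dz - x * dy) ^ 2.

Definition px (A : point) : R := fst (fst A).
Definition py (A : point) : R := snd (fst A).
Definition pz (A : point) : R := snd A.

Definition velocity (c : R -> point) (t : R) : vect :=
  (Derive (fun s => px (c s)) t,
   Derive (fun s => py (c s)) t,
   Derive (fun s => pz (c s)) t).

Definition arc_length (c : R -> point) (t0 t1 : R) : R :=
  RInt (fun t => sqrt (metric (c t) (velocity c t))) t0 t1.

Definition curve_from_origin (V : vect) (t : R) : point :=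
  let '(u, v, w) := V in
  (u * t, v * t, / 2 * u * v * t ^ 2 + w * t).

Definition translation_curve (P : point) (V : vect) (t : R) : point :=
  translation P (curve_from_origin V t).

(* Initial vector of the translation curve that starts at P1 (t = 0) and
   passes through P2 at t = 1; existence and uniqueness are the next two
   lemmas. *)
Definition initial_vector (P1 P2 : point) : vect :=
  let '(x, y, z) := translation_inv P1 P2 in (x, y, z - / 2 * x * y).

Lemma initial_vectorP (P1 P2 : point) :
  translation_curve P1 (initial_vector P1 P2) 0 = P1 /\
  translation_curve P1 (initial_vector P1 P2) 1 = P2.
Proof.
destruct P1 as [[p q] r], P2 as [[a b] c].
unfold translation_curve, initial_vector, translation_inv, curve_from_origin,
  translation.
split; repeat f_equal; field.
Qed.

Lemma initial_vector_unique (P1 P2 : point) (V : vect) :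
  translation_curve P1 V 1 = P2 -> V = initial_vector P1 P2.
Proof.
intros <-; unfold translation_curve, initial_vector.
rewrite translationK; destruct V as [[u v] w]; unfold curve_from_origin.
repeat f_equal; field.
Qed.

Definition dt (P1 P2 : point) : R :=
  arc_length (translation_curve P1 (initial_vector P1 P2)) 0 1.

Lemma dtE (P1 P2 : point) :
  dt P1 P2 =
  let '(x, y, z) := translation_inv P1 P2 in
  sqrt (x ^ 2 + y ^ 2 + (z - / 2 * x * y) ^ 2).
Proof.
unfold dt, arc_length, initial_vector.
destruct (translation_inv P1 P2) as [[x y] z], P1 as [[p q] r].
set (w := z - / 2 * x * y).
rewrite (RInt_ext _ (fun _ => sqrt (x ^ 2 + y ^ 2 + w ^ 2))).
- rewrite RInt_const; unfold scal; simpl; unfold mult; simpl; ring.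
- intros t _; f_equal.
  unfold velocity, translation_curve, translation, curve_from_origin, px, py, pz.
  rewrite (is_derive_unique _ t x) by (simpl; auto_derive; [exact I | ring]).
  rewrite (is_derive_unique _ t y) by (simpl; auto_derive; [exact I | ring]).
  rewrite (is_derive_unique _ t (p * y + x * y * t + w))
    by (simpl; auto_derive; [exact I | field]).
  unfold metric; ring.
Qed.

Definition on_translation_curve (P : point) (V : vect) (A : point) : Prop :=
  exists t : R, A = translation_curve P V t.

Definition translation_triangle (A1 A2 A3 : point) : Prop :=
  ~ (exists (P : point) (V : vect),
       on_translation_curve P V A1 /\
       on_translation_curve P V A2 /\
       on_translation_curve P V A3).

(* Main.v *)
Require Import Defs.
From Stdlib Require Import Reals Lra.
From Coquelicot Require Import Coquelicot.
Open Scope R_scope.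

(** Translation curves are the translates of one-parameter subgroups, so
    [dt O A] is the Euclidean norm of the logarithm of [A] in the Heisenberg
    Lie algebra. With A1 = O, A3 = exp X and A2 = exp X exp Y, the three sides
    have lengths |X|, |Y| and, by the Baker-Campbell-Hausdorff formula,
    |X + Y + [X,Y]/2|. For X = (s,0,0) and Y = (0,s,0) the bracket adds the
    vertical component s^2/2, which is quadratic in s, while |X| + |Y| = 2 s
    is only linear; so the inequality fails for s large. At s = 4 the long
    side is sqrt (16 + 16 + 64) > 8. The three points form a triangle because
    their projections to the (x, y)-plane are not collinear. *)

(** The projection to the (x, y)-plane maps translation curves into straight
    lines: the quadratic term only enters the third coordinate. *)
Lemma translation_triangle_of_noncollinear (A1 A2 A3 : point) :
  (px A2 - px A1) * (py A3 - py A1) <> (px A3 - px A1) * (py A2 - py A1) ->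
  translation_triangle A1 A2 A3.
Proof.
intros ncol [[[p q] r] [[[u v] w] [[t1 ->] [[t2 ->] [t3 ->]]]]].
apply ncol; unfold px, py; simpl; ring.
Qed.

Theorem lemma3p5 :
  exists A1 A2 A3 : point,
    translation_triangle A1 A2 A3 /\
    dt A2 A3 + dt A1 A3 < dt A1 A2.
Proof.
(* A2 is the product of A3 = (4,0,0) with (0,4,0), hence its height 4 * 4. *)
exists origin, (4, 4, 16), (4, 0, 0); split.
- apply translation_triangle_of_noncollinear; unfold px, py; simpl; lra.
- rewrite !dtE; unfold origin, translation_inv.
  replace (_ ^ 2 + _ + _) with (4 ^ 2) by field.
  replace ((4 - 0) ^ 2 + (0 - 0) ^ 2 + _) with (4 ^ 2) by field.
  rewrite sqrt_pow2 by lra.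
  replace (4 + 4) with (sqrt (8 ^ 2)) by (rewrite sqrt_pow2; lra).
  apply sqrt_lt_1; lra.
Qed.
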